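(* Let $f:\mathbb{R}\to\mathbb{R}$ be a continuous function which is strictly convex or strictly concave, and let $A,C\subset\mathbb{R}$ be finite sets with $|A|\approx|C|$. Then $$|f(A)+C|^6\,|A-A|^5\gg\frac{|A|^{14}}{(\log|A|)^2}.$$ In particular, taking $C=f(A)$, $$\max\{|f(A)+f(A)|,\ |A-A|\}\gg\frac{|A|^{14/11}}{(\log|A|)^{2/11}}.$$
   Context: $f(A)=\{f(a):a\in A\}$, $X+Y=\{x+y:x\in X,y\in Y\}$, $X-Y=\{x-y:x\in X,y\in Y\}$. $X\ll Y$ means $X\le cY$ for some absolute constant $c>0$, $X\gg Y$ means $Y\ll X$, and $X\approx Y$ means $X\ll Y$ and $Y\ll X$; the hypothesis $|A|\approx|C|$ means $K^{-1}|A|\le|C|\le K|A|$ for a fixed constant $K$, and the implied constant in the conclusion may depend on $K$. Logarithms are to base 2. *)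

(* Defs.v *)
From HB Require Import structures.
From mathcomp Require Export all_boot all_order all_algebra finmap.
From mathcomp Require Export all_classical all_reals all_analysis.

Set Implicit Arguments.
Unset Strict Implicit.
Unset Printing Implicit Defensive.

Export Order.TTheory GRing.Theory Num.Theory.
Export numFieldNormedType.Exports.

Local Open Scope fset_scope.
Local Open Scope ring_scope.

Definition strictly_convex (R : realType) (f : R -> R) : Prop :=
  forall x y t : R, x != y -> 0 < t -> t < 1 ->
    f (t * x + (1 - t) * y) < t * f x + (1 - t) * f y.

Definition strictly_concave (R : realType) (f : R -> R) : Prop :=
  forall x y t : R, x != y -> 0 < t -> t < 1 ->
    t * f x + (1 - t) * f y < f (t * x + (1 - t) * y).

Definition image_fset (R : realType) (f : R -> R) (X : {fset R}) : {fset R} :=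
  [fset f x | x in X].

Definition sumset (R : realType) (X Y : {fset R}) : {fset R} :=
  [fset x + y | x in X, y in Y].

Definition diffset (R : realType) (X Y : {fset R}) : {fset R} :=
  [fset x - y | x in X, y in Y].

Definition card (R : realType) (X : {fset R}) : R := #|` X |%:R.

(* Since ln x = 0 for x <= 0 and y / 0 = 0, the quotients by powers of
   log2 (card A) in the theorem are 0 when A has at most one element. *)
Definition log2 (R : realType) (x : R) : R := ln x / ln 2.

(* Main.v *)
Require Import Defs.
From mathcomp Require Import zify ring lra.

Set Implicit Arguments.
Unset Strict Implicit.
Unset Printing Implicit Defensive.

(** Convexity makes [f] strictly monotone on at least half of [A], and up to
    replacing [f], [C] by [-f], [-C] it is increasing there. For finite [B]
    and a set [S] of differences, the curves [y = f (x + b) + c] meet the grid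
    [S * (f(A) + C)] in the points [(a - b, f a + c)], which form an increasing
    chain on each curve, and two points of a curve determine it. Cutting the
    grid into rectangles of [p * q] points, a curve meets few rectangles and a
    pair of points in a common rectangle lies on at most one curve. This is the
    Szemeredi--Trotter bound for a grid, and it shows that the number of [x]
    with at least [t] representations [x = a - b] is
    [<< |f(A) + C|^2 |B|^2 / (|C| t^3)]. Summing over [t] gives
    [E_3(A) << |f(A) + C|^2 |A|^2 log |A| / |C|] and
    [E(A, D)^2 << |f(A) + C|^2 |A| |D|^3 / |C|] for [D = A - A]. The method of
    Schoen and Shkredov, namely Cauchy--Schwarz for [A] and
    [A_s = A :&: (A + s)], the inclusion of [A - A_s] in [D :&: (D - s)] and
    Hoelder's inequality, gives [|A|^8 <= E_3(A) E(A, D) |D|]. *)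

Local Open Scope fset_scope.
Local Open Scope ring_scope.

(** * Incidences of increasing chains with a grid cut into cells *)

Section Cells.
Local Open Scope nat_scope.

(** Elements of [X] alone in their class under [w] are determined by the value of [w], so there are
    at most [h] of them; every other element is the first entry of a counted pair. *)
Lemma card_le_classes_pairs (J : finType) (X : {set J}) (w : J -> nat) (h : nat) :
  {in X, forall j, w j < h} ->
  #|X| <= h + #|[set jj : J * J | [&& jj.1 \in X, jj.2 \in X,
                                      jj.1 != jj.2 & w jj.1 == w jj.2]]|.
Proof.
move=> wh; set Q := [set jj | _]; pose N := [set jj.1 | jj in Q]%SET.
rewrite -(cardsID N X) addnC leq_add //; last first.
  apply: leq_trans (leq_imset_card fst Q).
  exact/subset_leq_card/finset.subsetIr.
have wi : {in X :\: N &, injective w}.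
  move=> j k /finset.setDP[jX jN] /finset.setDP[kX _] jk; apply/eqP; apply: contraNT jN => njk.
  by apply/imsetP; exists (j, k) => //; rewrite inE /= jX kX njk jk eqxx.
rewrite cardE -(size_map w) -[h in _ <= h](size_iota 0).
apply: uniq_leq_size.
  rewrite map_inj_in_uniq ?enum_uniq // => j k; rewrite !mem_enum.
  exact: wi.
move=> x /mapP[j]; rewrite mem_enum => /finset.setDP[jX _] ->.
by rewrite mem_iota add0n wh.
Qed.

(** [I] indexes the curves, and [(u i j, v i j)] is the grid point number [j] on curve [i]. A curve
    meets at most [n %/ p + m %/ q + 1] cells. Any excess of points over cells is paid for by pairs
    in a common cell, and such a pair determines its curve. *)
Lemma monotone_incidences (I J : finType) (Z : {set I * J})
    (u v : I -> J -> nat) (n m p q : nat) :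
  0 < p -> 0 < q ->
  (forall i j, (i, j) \in Z -> u i j < n /\ v i j < m) ->
  (forall i j k, (i, j) \in Z -> (i, k) \in Z ->
    u i j <= u i k /\ v i j <= v i k \/ u i k <= u i j /\ v i k <= v i j) ->
  (forall i j k i' j' k', (i, j) \in Z -> (i, k) \in Z ->
    (i', j') \in Z -> (i', k') \in Z -> j != k ->
    u i j = u i' j' -> v i j = v i' j' -> u i k = u i' k' -> v i k = v i' k' ->
    (i, j, k) = (i', j', k')) ->
  #|Z| <= #|I| * (n %/ p + m %/ q).+1 + n * m * (p * q).
Proof.
move=> p0 q0 uv mono inj.
(* Along a chain both quotients grow together, so equal sums force both to agree: on one curve [w]
   distinguishes the cells. *)
pose w i j := u i j %/ p + v i j %/ q.
pose Q i := [set jk : J * J | [&& (i, jk.1) \in Z, (i, jk.2) \in Z,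
                                  jk.1 != jk.2 & w i jk.1 == w i jk.2]].
have -> : #|Z| = \sum_i #|[set j | (i, j) \in Z]|.
  rewrite -sum1_card; under [RHS]eq_bigr do rewrite -sum1dep_card.
  by rewrite pair_big_dep /=; apply: eq_bigl => -[].
apply: (@leq_trans (\sum_i ((n %/ p + m %/ q).+1 + #|Q i|))).
  apply: leq_sum => i _.
  apply: leq_trans (@card_le_classes_pairs _ _ (w i) (n %/ p + m %/ q).+1 _) _.
    move=> j; rewrite inE => /uv[un vm]; rewrite ltnS leq_add //.
      exact/leq_div2r/ltnW.
    exact/leq_div2r/ltnW.
  rewrite leq_add2l; apply/subset_leq_card/fintype.subsetP => jk.
  by rewrite !inE.
rewrite big_split /= sum_nat_const leq_add2l.
pose QQ := [set z : I * (J * J) | z.2 \in Q z.1].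
have -> : \sum_i #|Q i| = #|QQ|.
  rewrite -[RHS]sum1_card; under eq_bigr do rewrite -sum1_card.
  by rewrite pair_big_dep /=; apply: eq_bigl => -[i jk]; rewrite [RHS]inE.
have [->|/finset.set0Pn[[i0 [j0 k0]]]] := eqVneq QQ finset.set0; first by rewrite cards0.
rewrite !inE /= => /and4P[/uv[un vm] _ _ _].
case: n uv un => // n uv _; case: m uv vm => // m uv _.
case: p p0 @w @Q @QQ => // p _ w Q QQ; case: q q0 @w @Q @QQ => // q _ w Q QQ.
(* A pair in a common cell is encoded by its first point and the position of the second inside the
   cell; the cell itself is read off from the first point. *)
pose g (z : I * (J * J)) : 'I_n.+1 * 'I_m.+1 * ('I_p.+1 * 'I_q.+1) :=
  (inord (u z.1 z.2.1), inord (v z.1 z.2.1),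
   (inord (u z.1 z.2.2 %% p.+1), inord (v z.1 z.2.2 %% q.+1))).
have -> : n.+1 * m.+1 * (p.+1 * q.+1) =
    #|{: 'I_n.+1 * 'I_m.+1 * ('I_p.+1 * 'I_q.+1)}|.
  by rewrite !card_prod !card_ord.
apply: (@leq_card_in _ _ g).
have same i j k : (i, j) \in Z -> (i, k) \in Z -> w i j == w i k ->
    u i j %/ p.+1 = u i k %/ p.+1 /\ v i j %/ q.+1 = v i k %/ q.+1.
  move=> ij ik /eqP; rewrite /w.
  by case: (mono _ _ _ ij ik) => -[/(leq_div2r p.+1) + /(leq_div2r q.+1)]; lia.
move=> [i [j k]] [i' [j' k']]; rewrite !inE /=.
move=> /and4P[ij ik jk /(same _ _ _ ij ik)[uu vv]].
move=> /and4P[ij' ik' jk' /(same _ _ _ ij' ik')[uu' vv']].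
have [a1 a2] := uv _ _ ij; have [a3 a4] := uv _ _ ij'.
move=> [/(congr1 val) + /(congr1 val) + /(congr1 val) + /(congr1 val)].
rewrite /= !inordK ?ltn_pmod // => e1 e2 e3 e4.
have e5 : u i k = u i' k'.
  by rewrite (divn_eq (u i k) p.+1) (divn_eq (u i' k') p.+1) -uu -uu' e1 e3.
have e6 : v i k = v i' k'.
  by rewrite (divn_eq (v i k) q.+1) (divn_eq (v i' k') q.+1) -vv -vv' e2 e4.
by have [-> -> ->] := inj _ _ _ _ _ _ ij ik ij' ik' jk e1 e2 e5 e6.
Qed.

End Cells.

(** * Representation counts of differences, and ranks as grid coordinates *)

Definition rep (R : realType) (A B : {fset R}) (t : R) : nat :=
  (\sum_(a <- A) (a - t \in B)%R)%N.

Section Representations.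
Variable R : realType.
Implicit Types (A B C D F S T : {fset R}).

(** The substitution [t = a - b]: both sides sum [g] over the [t] in [S] with [a - t] in [B]. *)
Lemma sum_mem_sub S B (a : R) (g : R -> nat) :
  (\sum_(t <- S) (a - t \in B)%R * g t =
   \sum_(b <- B) (a - b \in S)%R * g (a - b)%R)%N.
Proof.
under eq_bigr do rewrite mulnbl; rewrite -big_mkcond.
under [RHS]eq_bigr do rewrite mulnbl; rewrite -[RHS]big_mkcond /=.
rewrite -big_filter -[RHS]big_filter.
rewrite -(big_map (fun b => a - b) xpredT g).
apply/perm_big/uniq_perm.
- exact/filter_uniq/fset_uniq.
- rewrite map_inj_uniq; first exact/filter_uniq/fset_uniq.
  by move=> x y /addrI/oppr_inj.
move=> x; rewrite mem_filter; apply/andP/mapP => [[xB xS]|[b]].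
  by exists (a - x); rewrite ?mem_filter subKr ?xS ?xB.
by rewrite mem_filter => /andP[aS bB] ->; rewrite subKr aS bB.
Qed.

Lemma sum_rep A B T (g : R -> nat) :
  (forall a b, a \in A -> b \in B -> a - b \in T) ->
  (\sum_(t <- T) rep A B t * g t = \sum_(a <- A) \sum_(b <- B) g (a - b)%R)%N.
Proof.
move=> ABT; under eq_bigr do rewrite /rep big_distrl.
rewrite exchange_big /=; apply: eq_big_seq => a aA.
rewrite sum_mem_sub; apply: eq_big_seq => b bB.
by rewrite ABT // mul1n.
Qed.

Lemma sum_rep_swap A B S :
  (\sum_(t <- S) rep A B t = \sum_(b <- B) \sum_(a <- A) (a - b \in S)%R)%N.
Proof.
rewrite exchange_big [RHS]exchange_big /=; apply: eq_bigr => a _.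
have := sum_mem_sub S B a (fun=> 1%N).
by under eq_bigr do rewrite muln1; under [X in _ = X]eq_bigr do rewrite muln1.
Qed.

Lemma rep_leql A B t : (rep A B t <= #|` A|)%N.
Proof.
by rewrite -[X in (_ <= X)%N]sum1_size; apply: leq_sum => a _; case: (_ \in _).
Qed.

Lemma rep_leqr A B t : (rep A B t <= #|` B|)%N.
Proof.
rewrite /rep -(big_map (fun a => a - t) xpredT (fun x => (x \in B) : nat)).
rewrite -big_mkcond sum1_count -size_filter; apply: uniq_leq_size.
  rewrite filter_uniq // map_inj_uniq ?fset_uniq //.
  exact: addIr.
by move=> x; rewrite mem_filter => /andP[].
Qed.

(** The position of [x] in the increasing enumeration of [S], counted from 0; it turns real
    coordinates into integer grid coordinates. *)
Definition rank S (x : R) := count (fun s => s < x) S.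

Lemma rank_le S x y : x <= y -> (rank S x <= rank S y)%N.
Proof. by move=> xy; apply: sub_count => s /= /lt_le_trans; apply. Qed.

Lemma rank_lt S x y : x \in S -> x < y -> (rank S x < rank S y)%N.
Proof.
move=> xS xy; rewrite /rank -!size_filter.
have uS := filter_uniq _ (fset_uniq S).
have -> : (size [seq s <- S | s < x]).+1 = size (x :: [seq s <- S | s < x]) by [].
apply: uniq_leq_size; first by rewrite /= uS mem_filter ltxx.
move=> z; rewrite inE !mem_filter => /predU1P[->|/andP[zx ->]]; first by rewrite xy.
by rewrite (lt_trans zx xy).
Qed.

Lemma rank_inj S : {in S &, injective (rank S)}.
Proof.
move=> x y xS yS e; apply/eqP; case: (ltgtP x y) => // h.
  by have := rank_lt xS h; rewrite e ltnn.
by have := rank_lt yS h; rewrite e ltnn.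
Qed.

Lemma rank_ltn S x : x \in S -> (rank S x < #|` S|)%N.
Proof.
move=> xS; rewrite /rank -(count_predC (fun s => s < x) S) -[X in (X < _)%N]addn0.
by rewrite ltn_add2l -has_count; apply/hasP; exists x => //=; rewrite ltxx.
Qed.

End Representations.

(** * Differences with many representations *)

Lemma card_le_image (R : realType) (g : R -> R) (X Y : {fset R}) :
  {in X &, injective g} -> (forall x, x \in X -> g x \in Y) ->
  (#|` X| <= #|` Y|)%N.
Proof.
move=> gi gY; rewrite -(size_map g); apply: uniq_leq_size.
  by rewrite map_inj_in_uniq ?fset_uniq.
by move=> y /mapP[x xX ->]; apply: gY.
Qed.

(** Fixing one summand embeds the set of the other summands into [F]. *)
Lemma card_le_sums (R : realType) (f : R -> R) (A C F : {fset R}) :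
  {in A &, {homo f : x y / x < y}} ->
  (forall a c, a \in A -> c \in C -> f a + c \in F) ->
  (0 < #|` A|)%N -> (0 < #|` C|)%N -> (#|` A| <= #|` F|)%N /\ (#|` C| <= #|` F|)%N.
Proof.
move=> fA ACF; rewrite !cardfs_gt0 => /fset0Pn[a aA] /fset0Pn[c cC]; split.
  apply: (@card_le_image _ (fun x => f x + c)) => [x y xA yA /addIr e|x xA].
    apply/eqP; case: (ltgtP x y) => // h.
      by have := fA _ _ xA yA h; rewrite e ltxx.
    by have := fA _ _ yA xA h; rewrite e ltxx.
  exact: ACF.
by apply: (@card_le_image _ (fun x => f a + x)) => [x y _ _ /addrI|x]//; apply: ACF.
Qed.

(** The form in which strict convexity enters the incidence count: a chord with given nonzero width
    and given rise has only one position on the graph, so two points of distinct abscissae lie on at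
    most one translate of it. *)
Definition separates_differences (R : realType) (f : R -> R) : Prop :=
  forall a b d, d != 0 -> f (a + d) - f a = f (b + d) - f b -> a = b.

Section Level.
Variable R : realType.
Implicit Types (A B C D F S T : {fset R}).

Lemma incidences_bound (f : R -> R) A B C F S (p q : nat) :
  (0 < p)%N -> (0 < q)%N ->
  {in A &, {homo f : x y / x < y}} -> separates_differences f ->
  (forall a c, a \in A -> c \in C -> f a + c \in F) ->
  (#|` C| * (\sum_(x <- S) rep A B x) <=
   #|` B| * #|` C| * (#|` S| %/ p + #|` F| %/ q).+1 +
   #|` S| * #|` F| * (p * q))%N.
Proof.
move=> p0 q0 fA fsep ACF.
(* The curve of [(b, c)] passes through [(a - b, f a + c)] for each [a]; only points with abscissa
   in [S] are kept. *)
pose Z := [set z : (B * C) * A | val z.2 - val z.1.1 \in S].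
pose u (i : B * C) (j : A) := rank S (val j - val i.1).
pose v (i : B * C) (j : A) := rank F (f (val j) + val i.2).
have FP (i : B * C) (j : A) : f (val j) + val i.2 \in F by apply: ACF; apply: valP.
have <- : #|Z| = (#|` C| * (\sum_(x <- S) rep A B x))%N.
  rewrite sum_rep_swap big_seq_fsetE /= big_distrr /=.
  rewrite -sum1dep_card big_mkcond /=.
  rewrite -(pair_big xpredT xpredT (fun (i : B * C) (j : A) =>
     if val j - val i.1 \in S then 1%N else 0%N)) /=.
  rewrite -(pair_big xpredT xpredT (fun (i : B) (k : C) =>
     (\sum_(j : A) if (val j - val i)%R \in S then 1%N else 0%N)%N)) /=.
  apply: eq_bigr => b _; rewrite sum_nat_const -cardfE; congr muln.
  by rewrite big_seq_fsetE; apply: eq_bigr => a _; case: (_ \in _).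
have -> : (#|` B| * #|` C|)%N = #|{: B * C}| by rewrite card_prod -!cardfE.
have faW : {in A &, {homo f : x y / x <= y}}.
  by move=> x y xA yA; rewrite le_eqVlt => /predU1P[->//|/fA/ltW]; apply.
apply: (@monotone_incidences _ _ Z u v) => //.
- by move=> i j; rewrite inE /= => jS; split; apply: rank_ltn.
- move=> i j k _ _; case/orP: (le_total (val j) (val k)) => jk; [left|right];
    by split; apply: rank_le; rewrite ?lerD2r // faW //; apply: valP.
move=> [b c] j k [b' c'] j' k'; rewrite !inE /= => jS kS jS' kS' jk.
move=> /(rank_inj jS jS')/= e1 /(rank_inj (FP (b, c) j) (FP (b', c') j'))/= e2.
move=> /(rank_inj kS kS')/= e3 /(rank_inj (FP (b, c) k) (FP (b', c') k'))/= e4.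
(* Both curves go through the same two points, so the chords from [j] to [k] and from [j'] to [k']
   have equal width and rise. *)
have jj : val j = val j'.
  apply: (fsep _ _ (val k - val j)); first by rewrite subr_eq0 eq_sym (inj_eq val_inj).
  rewrite subrKC; have -> : val j' + (val k - val j) = val k' by rewrite /=; lra.
  by rewrite /=; lra.
have -> : j = j' by apply: val_inj.
rewrite /= in jj; have -> : k = k' by apply: val_inj => /=; lra.
have -> : b = b' by apply: val_inj => /=; lra.
by have -> : c = c' by apply: val_inj => /=; move: e2; rewrite jj => /addrI.
Qed.

(** Optimises the incidence bound in the cell size. For [p] near [4b/t] and [q] near [4bF/(nt)],
    each of the three terms in the first summand is at most a quarter of the left side, so the grid
    term is at least the remaining quarter. *)
Lemma rich_count_bound (n t a b c F : nat) :
  (0 < n -> t <= a /\ t <= b)%N -> (a <= F)%N -> (c <= F)%N -> (n * t <= a * b)%N ->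
  (forall p q, 0 < p -> 0 < q ->
     c * (n * t) <= b * c * (n %/ p + F %/ q).+1 + n * F * (p * q))%N ->
  (n * t ^ 3 * c <= 100 * (F ^ 2 * b ^ 2))%N.
Proof.
move=> tab aF cF ntab H.
have [->|n0] := posnP n; first by rewrite !mul0n.
have [->|t0] := posnP t; first by rewrite exp0n // muln0.
have [ta tb] := tab n0.
have -> : (n * t ^ 3 * c = (n * t) * (t * (t * c)))%N by ring.
have tcF : (t * c <= F * F)%N by rewrite leq_mul // (leq_trans ta).
(* If [n * t < 4 * b], the [+1] cannot be absorbed, but [t <= b] and [t * c <= F ^ 2] already
   suffice. *)
have [ntb|ntb] := ltnP (n * t) (4 * b).
  apply: (@leq_trans (4 * b * (b * (F * F)))).
    by rewrite leq_mul ?(ltnW ntb) // leq_mul.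
  by rewrite -!mulnn; nia.
have nt0 : (0 < n * t)%N by rewrite muln_gt0 n0.
have F0 : (0 < F)%N by rewrite (leq_trans t0) // (leq_trans ta).
have nt1 : (n * t <= b * F)%N by rewrite (leq_trans ntab) // mulnC leq_mul.
(* Rounding up is harmless: [t <= b] and [n * t <= b * F] give [p * t <= 5 * b] and
   [q * (n * t) <= 5 * (b * F)]. The final constant is [100 = 4 * 5 * 5]. *)
set p := (4 * b %/ t).+1; set q := (4 * b * F %/ (n * t)).+1.
have p1 : (4 * b <= p * t)%N by rewrite ltnW // ltn_ceil.
have p2 : (p * t <= 5 * b)%N.
  by rewrite /p mulSn; have := leq_trunc_div (4 * b) t; lia.
have q1 : (4 * b * F <= q * (n * t))%N by rewrite ltnW // ltn_ceil.
have q2 : (q * (n * t) <= 5 * (b * F))%N.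
  by rewrite /q mulSn; have := leq_trunc_div (4 * b * F) (n * t); lia.
have {}H := H p q isT isT; move: H.
have := leq_trunc_div n p; have := leq_trunc_div F q.
clearbody p q; move: (n %/ p)%N (F %/ q)%N => x y yq xp H.
have hx : (4 * b * x <= n * t)%N.
  apply: (@leq_trans (p * t * x)); first exact: leq_mul.
  by rewrite mulnAC mulnC [(p * x)%N]mulnC [(n * t)%N]mulnC leq_mul.
have hy : (4 * b * y <= n * t)%N.
  rewrite -(leq_pmul2r F0); apply: (@leq_trans (q * (n * t) * y)).
    by rewrite mulnAC leq_mul.
  by rewrite mulnAC mulnC leq_mul // mulnC.
have h1 : (4 * (b * c * (x + y).+1) <= 3 * (c * (n * t)))%N.
  have -> : (4 * (b * c * (x + y).+1) = c * (4 * b * x + 4 * b * y + 4 * b))%N by ring.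
  by rewrite mulnCA leq_mul2l; lia.
have h2 : (c * (n * t) <= 4 * (n * F * (p * q)))%N by lia.
have h3 : (t * c <= 4 * (F * (p * q)))%N.
  by rewrite -(leq_pmul2l n0); lia.
apply: (@leq_trans (n * t * (t * (4 * (F * (p * q)))))).
  by rewrite !leq_mul2l h3 !orbT.
have -> : (n * t * (t * (4 * (F * (p * q)))) = 4 * F * ((p * t) * (q * (n * t))))%N by ring.
apply: (@leq_trans (4 * F * ((5 * b) * (5 * (b * F))))); first by rewrite leq_mul2l leq_mul // orbT.
by apply: eq_leq; ring.
Qed.

(** At least [|S| t] pairs [(a, b)] have their difference in [S], and each gives [|C|] incidences;
    [rich_count_bound] then applies. *)
Lemma rich_differences_bound (f : R -> R) A B C F S (t : nat) :
  {in A &, {homo f : x y / x < y}} -> separates_differences f ->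
  (forall a c, a \in A -> c \in C -> f a + c \in F) ->
  (forall x, x \in S -> (t <= rep A B x)%N) ->
  (#|` S| * t ^ 3 * #|` C| <= 100 * (#|` F| ^ 2 * #|` B| ^ 2))%N.
Proof.
move=> fA fsep ACF St.
have [->|C0] := posnP #|` C|; first by rewrite muln0.
have [->|S0] := posnP #|` S|; first by rewrite !mul0n.
have [->|t0] := posnP t; first by rewrite exp0n // muln0.
have [x0 /St xS] : exists x, x \in S by apply/fset0Pn; rewrite -cardfs_gt0.
have A0 : (0 < #|` A|)%N.
  by rewrite (leq_trans t0) // (leq_trans xS) // rep_leql.
have [cAF cCF] := card_le_sums fA ACF A0 C0.
have ntS : (#|` S| * t <= \sum_(x <- S) rep A B x)%N.
  rewrite -sum1_size big_distrl /= big_seq [X in (_ <= X)%N]big_seq.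
  by apply: leq_sum => x /St; rewrite mul1n.
apply: (@rich_count_bound _ _ #|` A|) => //.
- by move=> _; split; apply: leq_trans xS _; [exact: rep_leql | exact: rep_leqr].
- apply: leq_trans ntS _; rewrite sum_rep_swap mulnC -[in X in (_ <= X)%N]sum1_size.
  rewrite big_distrl /=; apply: leq_sum => b _; rewrite mul1n.
  by rewrite -sum1_size; apply: leq_sum => a _; case: (_ \in _).
move=> p q p0 q0.
apply: leq_trans (incidences_bound B S p0 q0 fA fsep ACF).
by rewrite leq_mul2l ntS orbT.
Qed.

End Level.

(** * Energies, Cauchy--Schwarz and the sets [A_s] *)

Section Energy.
Variable R : realType.
Implicit Types (A B C D F S T : {fset R}).

(** The set [A_s = A :&: (A + s)]. *)
Definition section A (s : R) : {fset R} := [fset z in A | z - s \in A].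

Lemma card_section A s : #|` section A s| = rep A A s.
Proof.
rewrite /rep -big_mkcond sum1_count -size_filter.
apply/perm_size/uniq_perm; rewrite ?fset_uniq ?filter_uniq ?fset_uniq //.
by move=> x; rewrite !inE mem_filter andbC.
Qed.

Lemma diffsetP A B x :
  reflect (exists a b, [/\ a \in A, b \in B & x = a - b]) (x \in diffset A B).
Proof.
apply: (iffP idP) => [/imfset2P[a aA [b bB ->]]|[a [b [aA bB ->]]]].
  by exists a, b.
by apply/imfset2P; exists a => //; exists b.
Qed.

Lemma mem_diffset A B a b : a \in A -> b \in B -> a - b \in diffset A B.
Proof. by move=> aA bB; apply/diffsetP; exists a, b. Qed.

Lemma sum_rep_card A B T :
  (forall a b, a \in A -> b \in B -> a - b \in T) ->
  (\sum_(t <- T) rep A B t = #|` A| * #|` B|)%N.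
Proof.
move=> ABT; under eq_bigr do rewrite -[rep _ _ _]muln1.
rewrite (sum_rep (fun=> 1%N) ABT); under eq_bigr do rewrite sum1_size.
by rewrite big_const_seq count_predT iter_addn_0 mulnC.
Qed.

(** Cauchy--Schwarz against the constant 1: after doubling, both sides are double sums, compared
    termwise by [2xy <= x^2 + y^2]. *)
Lemma sum_sqr_le (T : seq R) (r : R -> nat) :
  ((\sum_(t <- T) r t) ^ 2 <= size T * \sum_(t <- T) r t ^ 2)%N.
Proof.
rewrite -(leq_pmul2l (isT : 0 < 2)%N) -mulnn big_distrl /=.
under eq_bigr do rewrite big_distrr /=.
have -> : (2 * (size T * \sum_(t <- T) r t ^ 2) =
    \sum_(t <- T) \sum_(s <- T) (r t ^ 2 + r s ^ 2))%N.
  under [RHS]eq_bigr do rewrite big_split /= big_const_seq count_predT iter_addn_0.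
  by rewrite big_split /= -big_distrl /= big_const_seq count_predT iter_addn_0; lia.
rewrite big_distrr /=; apply: leq_sum => t _.
by rewrite big_distrr /=; apply: leq_sum => s _; exact: nat_Cauchy.
Qed.

(** Cauchy--Schwarz over the actual differences. The energy is summed over a larger [T] so that one
    range can serve all sections. *)
Lemma card_sqr_le_energy A B T :
  (forall a b, a \in A -> b \in B -> a - b \in T) ->
  ((#|` A| * #|` B|) ^ 2 <=
   #|` diffset A B| * \sum_(t <- T) rep A B t ^ 2)%N.
Proof.
move=> ABT; rewrite -(sum_rep_card (@mem_diffset A B)).
apply: leq_trans (sum_sqr_le _ _) _; rewrite leq_mul2l; apply/orP; right.
have sDT : {subset diffset A B <= T} by move=> _ /diffsetP[a [b [aA bB ->]]]; apply: ABT.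
rewrite [X in (_ <= X)%N](bigID (mem (diffset A B))) /=; apply: leq_trans (leq_addr _ _).
rewrite -[X in (_ <= X)%N]big_filter; apply/eq_leq/perm_big/uniq_perm;
  rewrite ?fset_uniq ?filter_uniq ?fset_uniq //.
move=> x; rewrite mem_filter; case: (boolP (x \in diffset A B)) => [/sDT ->|]//.
Qed.

(* Katz--Koester: for [z] in [section A s] both [a - z] and
   [a - z + s = a - (z - s)] are in [A - A]. *)
Lemma sum_section_diffset_le A D :
  (forall a b, a \in A -> b \in A -> a - b \in D) ->
  (\sum_(s <- D) rep A A s * #|` diffset A (section A s)| <=
   \sum_(t <- diffset A D) rep A D t ^ 2)%N.
Proof.
move=> AD.
apply: (@leq_trans (\sum_(s <- D) rep A A s * \sum_(y <- D) (y + s \in D)%R)).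
  apply: leq_sum => s _; rewrite leq_mul2l; apply/orP; right.
  rewrite -big_mkcond sum1_count -size_filter; apply: uniq_leq_size; first exact: fset_uniq.
  move=> x /diffsetP[a [z [aA]]]; rewrite !inE /= => /andP[zA zsA] ->.
  rewrite mem_filter AD // andbT; have -> : a - z + s = a - (z - s) by ring.
  exact: AD.
(* Both sides become the number of triples [a, b] in [A], [y] in [D] with [y + b - a] in [D]. *)
rewrite (sum_rep (fun s => \sum_(y <- D) (y + s \in D)%R)%N AD).
under [X in (_ <= X)%N]eq_bigr do rewrite expnS expn1.
rewrite (sum_rep (rep A D) (@mem_diffset A D)) exchange_big /=.
apply/eq_leq/eq_bigr => a _; rewrite exchange_big /=; apply: eq_bigr => y _.
by apply: eq_bigr => b _; have -> : y + (b - a) = b - (a - y) by ring.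
Qed.

(** Both sides count triples of pairs from [A] with a common difference: [(a, b)], [(a - t, b - t)],
    [(a - t - s, b - t - s)]. *)
Lemma sum_section_energy A D :
  (forall a b, a \in A -> b \in A -> a - b \in D) ->
  (\sum_(s <- D) \sum_(t <- D) rep A (section A s) t ^ 2 =
   \sum_(t <- D) rep A A t ^ 3)%N.
Proof.
move=> AD.
have E s t : (rep A (section A s) t ^ 2 = \sum_(a <- A) \sum_(b <- A)
    (a - t \in A)%R * ((b - t \in A)%R * ((a - t - s \in A)%R * (b - t - s \in A)%R)))%N.
  rewrite -mulnn /rep big_distrl /=; apply: eq_bigr => a _.
  rewrite big_distrr /=; apply: eq_bigr => b _.
  by rewrite !inE /=; do 4 case: (_ \in _).
under eq_bigr do under eq_bigr do rewrite E.
under eq_bigr do rewrite exchange_big /=.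
rewrite exchange_big /=.
under [RHS]eq_bigr do rewrite expnS.
rewrite (sum_rep (fun t => rep A A t ^ 2)%N AD); apply: eq_big_seq => a aA.
under eq_bigr do rewrite exchange_big /=.
rewrite exchange_big /=; apply: eq_big_seq => b bA.
(* Replace [t] by [w = a - t], and later [s] by [z = w - s]; the conditions left on [w] and [z] each
   count representations of [a - b]. *)
under eq_bigr do rewrite (sum_mem_sub D A a (fun t => (b - t \in A)%R *
  ((a - t - _ \in A)%R * (b - t - _ \in A)%R))%N).
rewrite exchange_big /= -mulnn {1}/rep big_distrl /=; apply: eq_big_seq => w wA.
rewrite AD //.
under eq_bigr do rewrite mul1n.
rewrite -big_distrr /=; have -> : b - (a - w) = w - (a - b) by ring.
congr muln.
have -> : a - (a - w) = w by ring.
rewrite (sum_mem_sub D A w (fun t => (w - (a - b) - t \in A)%R : nat)).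
apply: eq_big_seq => z zA; rewrite AD // mul1n.
by have -> : w - (a - b) - (w - z) = z - (a - b) by ring.
Qed.

(** * Hoelder's inequality for three factors and its application *)

Lemma exists_cube_root (k : R) : 0 <= k -> exists2 y, 0 <= y & y ^+ 3 = k.
Proof.
move=> k0; exists (k `^ 3^-1); first exact: powR_ge0.
by rewrite -powR_mulrn ?powR_ge0 // -powRrM mulVf ?powRr1.
Qed.

Lemma amgm3 (a b c : R) : 0 <= a -> 0 <= b -> 0 <= c ->
  a * b * c <= ((a + b + c) / 3) ^+ 3.
Proof.
move=> a0 b0 c0.
(* [(a + b + c)^3 - 27abc] is [7/2] times the sum of the first three products plus [1/2] times the
   sum of the last three. *)
have h1 := mulr_ge0 a0 (sqr_ge0 (b - c)).
have h2 := mulr_ge0 b0 (sqr_ge0 (a - c)).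
have h3 := mulr_ge0 c0 (sqr_ge0 (a - b)).
have h4 := mulr_ge0 (addr_ge0 a0 b0) (sqr_ge0 (a - b)).
have h5 := mulr_ge0 (addr_ge0 a0 c0) (sqr_ge0 (a - c)).
have h6 := mulr_ge0 (addr_ge0 b0 c0) (sqr_ge0 (b - c)).
lra.
Qed.

(** After division by the cube root [P] of [X * Y * Z], AM-GM bounds each term by the mean of
    [x i / X], [y i / Y] and [z i / Z], and these means sum to 1. *)
Lemma hoelder3 (I : eqType) (T : seq I) (w x y z : I -> R) :
  (forall i, 0 <= w i) -> (forall i, 0 <= x i) ->
  (forall i, 0 <= y i) -> (forall i, 0 <= z i) ->
  (forall i, i \in T -> w i ^+ 3 <= x i * y i * z i) ->
  (\sum_(i <- T) w i) ^+ 3 <=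
  (\sum_(i <- T) x i) * (\sum_(i <- T) y i) * (\sum_(i <- T) z i).
Proof.
move=> w0 x0 y0 z0 H.
set X := \sum_(i <- T) x i; set Y := \sum_(i <- T) y i; set Z := \sum_(i <- T) z i.
have X0 : 0 <= X by apply: sumr_ge0.
have Y0 : 0 <= Y by apply: sumr_ge0.
have Z0 : 0 <= Z by apply: sumr_ge0.
have [P P0 PE] := exists_cube_root (mulr_ge0 (mulr_ge0 X0 Y0) Z0).
rewrite -PE ler_pXn2r ?nnegrE ?sumr_ge0 //.
have Wz (g : I -> R) i : (forall j, 0 <= g j) -> \sum_(j <- T) g j = 0 ->
    i \in T -> g i = 0.
  move=> g0 /eqP; rewrite psumr_eq0 // => /allP h iT.
  by have /= := h _ iT; move/eqP.
(* If one of the three sums vanishes, so do all its terms, and hence every [w i]. *)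
have [XYZ|XYZ] := eqVneq (X * Y * Z) 0.
  rewrite big_seq big1 // => i iT.
  have : w i ^+ 3 <= 0.
    apply: le_trans (H _ iT) _.
    by move/eqP: XYZ; rewrite !mulf_eq0 -orbA => /or3P[] /eqP h;
      rewrite (Wz _ _ _ h iT) // ?(mul0r, mulr0).
  move=> wi; have : w i ^+ 3 == 0 by rewrite eq_le wi exprn_ge0.
  by rewrite expf_eq0 => /eqP.
have Pp : 0 < P.
  rewrite lt_neqAle P0 andbT eq_sym; apply: contraNneq XYZ => Pz.
  by rewrite -PE Pz expr0n.
move: XYZ; rewrite !mulf_eq0 !negb_or -!andbA => /and3P[Xn Yn Zn].
rewrite -[P]mul1r -ler_pdivrMr // mulr_suml.
apply: (@le_trans _ _ (\sum_(i <- T) ((x i / X + y i / Y + z i / Z) / 3))).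
  rewrite big_seq [leRHS]big_seq; apply: ler_sum => i iT.
  have a0 : 0 <= x i / X by rewrite divr_ge0.
  have b0 : 0 <= y i / Y by rewrite divr_ge0.
  have c0 : 0 <= z i / Z by rewrite divr_ge0.
  rewrite -(@ler_pXn2r _ 3) ?nnegrE ?divr_ge0 ?addr_ge0 //.
  apply: le_trans (amgm3 a0 b0 c0).
  rewrite expr_div_n PE.
  have -> : x i / X * (y i / Y) * (z i / Z) = x i * y i * z i / (X * Y * Z).
    by field; rewrite Xn Yn Zn.
  by rewrite ler_wpM2r ?invr_ge0 ?mulr_ge0 // H.
rewrite -mulr_suml !big_split /= -!mulr_suml -/X -/Y -/Z !divff //.
lra.
Qed.

Lemma card_exp8_le A D :
  (forall a b, a \in A -> b \in A -> a - b \in D) ->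
  (#|` A| ^ 8 <= (\sum_(t <- D) rep A A t ^ 3) *
     (\sum_(t <- diffset A D) rep A D t ^ 2) * #|` D|)%N.
Proof.
move=> AD; have [->|A0] := posnP #|` A|; first by rewrite exp0n.
rewrite -(sum_section_energy AD).
apply: (@leq_trans ((\sum_(s <- D) \sum_(t <- D) rep A (section A s) t ^ 2) *
     (\sum_(s <- D) rep A A s * #|` diffset A (section A s)|) * #|` D|)).
  2: by rewrite leq_mul2r leq_mul2l sum_section_diffset_le ?orbT.
rewrite -(ler_nat R).
(* With [k^3 = |A|^2] the left side of Hoelder is [|A|^2 (|A|^2)^3 = |A|^8], and the termwise
   hypothesis is Cauchy--Schwarz for [A] and [A_s] multiplied by [|A_s|]. *)
have [k k0 kE] := exists_cube_root (ler0n R (#|` A| ^ 2)).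
have := @hoelder3 _ D (fun s => k * (rep A A s)%:R)
  (fun s => (\sum_(t <- D) rep A (section A s) t ^ 2)%:R)
  (fun s => (rep A A s * #|` diffset A (section A s)|)%:R) (fun=> 1%N%:R).
rewrite -!natr_sum -mulr_sumr -natr_sum sum_rep_card // sum1_size exprMn kE -natrX -!natrM.
have -> : (#|` A| ^ 2 * (#|` A| * #|` A|) ^ 3 = #|` A| ^ 8)%N by ring.
apply => // [s|s _]; first exact: mulr_ge0.
rewrite exprMn kE -natrX -!natrM muln1 ler_nat.
have /card_sqr_le_energy : forall a b, a \in A -> b \in section A s -> a - b \in D.
  by move=> a b aA; rewrite !inE => /andP[bA _]; exact: AD.
rewrite card_section; set g := #|` diffset _ _|; set e := (\sum_(t <- D) _)%N => h.
apply: (@leq_trans (rep A A s * ((#|` A| * rep A A s) ^ 2))); first by apply: eq_leq; ring.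
apply: (@leq_trans (rep A A s * (g * e))); first by rewrite leq_mul2l h orbT.
by apply: eq_leq; ring.
Qed.

(** * Moments from level-set bounds *)

(** Induction with [1/(n+2) <= ln ((n+2)/(n+1))], which is [ln (1 + x) <= x] at [x = -1/(n+2)]. *)
Lemma harmonic_le_ln (n : nat) : (0 < n)%N ->
  \sum_(1 <= t < n.+1) (t%:R^-1 : R) <= 1 + ln n%:R.
Proof.
case: n => // n _; elim: n => [|n IH]; first by rewrite big_nat1 invr1 ln1 addr0.
rewrite big_nat_recr //=; apply: le_trans (lerD IH (lexx _)) _.
rewrite -addrA lerD2l -lerBrDl -ln_div ?posrE //.
have -> : n.+2%:R / n.+1%:R = (n.+1%:R / n.+2%:R)^-1 :> R by rewrite invf_div.
rewrite lnV ?posrE ?divr_gt0 // lerNr.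
have -> : n.+1%:R / n.+2%:R = 1 + - (n.+2%:R^-1) :> R.
  have -> : n.+1%:R = n.+2%:R - 1 :> R by rewrite -[n.+2%:R]natr1 addrK.
  by rewrite mulrBl divff ?pnatr_eq0 // mul1r.
by apply: le_ln1Dx; rewrite ltrN2 invf_lt1 ?ltr1n.
Qed.

Lemma sum_inv_sqr_tail (d n : nat) : (0 < d)%N ->
  \sum_(1 <= t < n.+1) (d < t)%:R * (t%:R ^+ 2)^-1 <= d%:R^-1 :> R.
Proof.
move=> d0.
(* The sharper bound telescopes, by [1/(n+1)^2 <= 1/n - 1/(n+1)]. *)
suff : \sum_(1 <= t < n.+1) (d < t)%:R * (t%:R ^+ 2)^-1 <=
    d%:R^-1 - (maxn d n)%:R^-1 :> R.
  by move/le_trans; apply; rewrite gerBl invr_ge0.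
elim: n => [|n IH]; first by rewrite big_geq // maxn0 subrr.
rewrite big_nat_recr //; apply: le_trans (lerD IH (lexx _)) _.
have [dn|dn] := ltnP d n.+1; last first.
  by rewrite mul0r addr0 (maxn_idPl (ltnW dn)).
rewrite mul1r (maxn_idPr (dn : (d <= n)%N)).
have n0 : 0 < n%:R :> R by rewrite ltr0n (leq_trans d0).
rewrite -addrA lerD2l -subr_ge0.
have -> : n.+1%:R = n%:R + 1 :> R by rewrite natr1.
have -> : - (n%:R + 1)^-1 - (- n%:R^-1 + ((n%:R + 1) ^+ 2)^-1) =
   (n%:R * (n%:R + 1) ^+ 2)^-1 :> R.
  by field; rewrite gt_eqF // gt_eqF // addr_gt0.
by rewrite invr_ge0 mulr_ge0 ?exprn_ge0 ?addr_ge0 // ltW.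
Qed.

Lemma sum_layers (g : nat -> nat) (r n : nat) : (r <= n)%N ->
  (\sum_(1 <= t < n.+1) (t <= r) * g t = \sum_(1 <= t < r.+1) g t)%N.
Proof.
move=> rn; rewrite [RHS](@big_nat_widen _ _ _ _ _ n.+1) //= [RHS]big_mkcond /=.
by apply: eq_bigr => t _; rewrite ltnS mulnbl.
Qed.

(** Layer-cake formula: [x] contributes [g t] once for every [t] from 1 to [r x]. *)
Lemma sum_layers_seq (T : seq R) (r : R -> nat) (g : nat -> nat) (n : nat) :
  (forall x, r x <= n)%N ->
  (\sum_(x <- T) \sum_(1 <= t < (r x).+1) g t =
   \sum_(1 <= t < n.+1) count (fun x => t <= r x) T * g t)%N.
Proof.
move=> rn; under eq_bigr do rewrite -(sum_layers g (rn _)).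
rewrite exchange_big /=; apply: eq_bigr => t _.
by rewrite -big_distrl /= -big_mkcond sum1_count.
Qed.

(** [r^3] is at most three times the sum of [t^2] over [t <= r], and level [t] weighted by [t^2]
    contributes at most [M / t]. The harmonic sum is the source of the logarithm. *)
Lemma sum_cube_le (T : seq R) (r : R -> nat) (n : nat) (M : R) : (0 < n)%N ->
  (forall x, r x <= n)%N -> 0 <= M ->
  (forall t, (0 < t)%N -> (count (fun x => t <= r x)%N T)%:R * t%:R ^+ 3 <= M) ->
  (\sum_(x <- T) r x ^ 3)%:R <= 3 * M * (1 + ln n%:R).
Proof.
move=> n0 rn M0 H.
have h r0 : (r0 ^ 3 <= 3 * \sum_(1 <= t < r0.+1) t ^ 2)%N.
  suff : (r0 * (r0 + 1) * (2 * r0 + 1) = 6 * \sum_(1 <= t < r0.+1) t ^ 2)%N by nia.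
  elim: r0 => [|k IH]; first by rewrite big_geq.
  by rewrite big_nat_recr //= [RHS]mulnDr -IH; ring.
apply: (@le_trans _ _ (3 * \sum_(1 <= t < n.+1) count (fun x => t <= r x) T * t ^ 2)%N%:R).
  by rewrite ler_nat -(sum_layers_seq _ _ rn) big_distrr; apply: leq_sum.
rewrite natrM -mulrA ler_pM2l //.
apply: (@le_trans _ _ (M * \sum_(1 <= t < n.+1) t%:R^-1)).
  rewrite natr_sum mulr_sumr big_nat [leRHS]big_nat; apply: ler_sum => t /andP[t0 _].
  rewrite ler_pdivlMr ?ltr0n //; apply: le_trans (H t t0).
  by rewrite natrM natrX -mulrA -exprSr.
by rewrite ler_wpM2l // harmonic_le_ln.
Qed.

(** Levels up to a cut [d] contribute at most [d W], higher ones at most [M / d]; the cut near the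
    square root of [M / W] balances the two. *)
Lemma sum_sqr_le_geom (T : seq R) (r : R -> nat) (n : nat) (M W : R) :
  (forall x, r x <= n)%N -> W = (\sum_(x <- T) r x)%:R -> W <= M ->
  (forall t, (0 < t)%N -> (count (fun x => t <= r x)%N T)%:R * t%:R ^+ 3 <= M) ->
  (\sum_(x <- T) r x ^ 2)%:R ^+ 2 <= 36 * (M * W).
Proof.
move=> rn WE WM H.
have W0 : 0 <= W by rewrite WE.
have M0 : 0 <= M by apply: le_trans WM.
have h r0 : (r0 ^ 2 <= 2 * \sum_(1 <= t < r0.+1) t)%N.
  suff : (r0 * (r0 + 1) = 2 * \sum_(1 <= t < r0.+1) t)%N by nia.
  elim: r0 => [|k IH]; first by rewrite big_geq.
  by rewrite big_nat_recr //= [RHS]mulnDr -IH; ring.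
have key (d : nat) : (0 < d)%N ->
    (\sum_(x <- T) r x ^ 2)%:R <= 2 * (d%:R * W + M / d%:R).
  move=> d0.
  apply: (@le_trans _ _ (2 * \sum_(1 <= t < n.+1) count (fun x => t <= r x) T * t)%N%:R).
    by rewrite ler_nat -(sum_layers_seq _ id rn) big_distrr; apply: leq_sum.
  rewrite natrM ler_pM2l //.
  have -> : W = \sum_(1 <= t < n.+1) (count (fun x => t <= r x)%N T)%:R.
    rewrite WE -natr_sum; congr (_%:R).
    transitivity (\sum_(x <- T) \sum_(1 <= t < (r x).+1) 1)%N.
      by apply: eq_bigr => x _; rewrite sum_nat_const_nat subn1 muln1.
    by rewrite (sum_layers_seq _ _ rn); apply: eq_bigr => t _; rewrite muln1.
  apply: (@le_trans _ _ (\sum_(1 <= t < n.+1)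
     (d%:R * (count (fun x => t <= r x)%N T)%:R + M * ((d < t)%:R * (t%:R ^+ 2)^-1)))).
    rewrite natr_sum big_nat [leRHS]big_nat; apply: ler_sum => t /andP[t0 _].
    rewrite natrM; have [dt|td] := ltnP d t.
      rewrite mul1r; apply: (@le_trans _ _ (M / t%:R ^+ 2)).
        by rewrite ler_pdivlMr ?exprn_gt0 ?ltr0n // -mulrA -exprS H.
      by rewrite lerDr mulr_ge0.
    by rewrite mul0r mulr0 addr0 mulrC ler_wpM2r // ler_nat.
  rewrite big_split /= -!mulr_sumr lerD2l ler_wpM2l //.
  exact: sum_inv_sqr_tail.
have [Wz|Wn] := eqVneq W 0.
  have rz : (\sum_(x <- T) r x = 0)%N by apply/eqP; rewrite -(eqr_nat R) -WE Wz.
  rewrite Wz !mulr0 big_seq big1 ?expr0n // => x xT.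
  by move/eqP: rz; rewrite sum_nat_seq_eq0 => /allP/(_ _ xT)/= /eqP ->.
have Wp : 0 < W by rewrite lt_neqAle eq_sym Wn.
pose x := Num.sqrt (M / W).
have xE : M = x ^+ 2 * W by rewrite sqr_sqrtr ?divr_ge0 // divfK.
have x1 : 1 <= x.
  by rewrite -(@sqrtr1 R) ler_sqrt ?divr_ge0 // ler_pdivlMr // mul1r.
have x0 : 0 < x by apply: lt_le_trans x1.
have /andP[d1 d2] := truncn_itv (ltW x0).
(* [W <= M] gives [1 <= x], so this cut lies between [x] and [2 x]; hence the factor
   [2 * (2 + 1) = 6], and [36] after squaring. *)
have := key (Num.truncn x).+1 isT; set E := (\sum_(_ <- T) _)%:R; move=> K1.
have K2 : E <= 6 * (x * W).
  apply: le_trans K1 _.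
  have -> : 6 * (x * W) = 2 * (2 * x * W + x * W) by ring.
  rewrite ler_pM2l // lerD //.
    by rewrite ler_pM2r // -natr1; lra.
  rewrite xE ler_pdivrMr ?ltr0n //; have -> : x ^+ 2 * W = x * W * x by ring.
  by rewrite ler_pM2l ?mulr_gt0 // ltW.
have -> : 36 * (M * W) = (6 * (x * W)) ^+ 2 by rewrite xE; ring.
by rewrite ler_pXn2r ?nnegrE // mulr_ge0 // mulr_ge0 // ltW.
Qed.

End Energy.

(** * The sum-difference inequality for increasing functions *)

Section SumDifference.
Variable R : realType.
Implicit Types (A B C D F S T : {fset R}) (f : R -> R).

Lemma rep_level_bound f A B C F T (t : nat) :
  {in A &, {homo f : x y / x < y}} -> separates_differences f ->
  (forall a c, a \in A -> c \in C -> f a + c \in F) -> (0 < #|` C|)%N ->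
  (count (fun x => t <= rep A B x)%N T)%:R * t%:R ^+ 3 <=
  100 * (#|` F|%:R ^+ 2 * #|` B|%:R ^+ 2) / #|` C|%:R :> R.
Proof.
move=> fA fsep ACF C0; rewrite ler_pdivlMr ?ltr0n // -!natrX -!natrM ler_nat.
pose S := [fset x in T | (t <= rep A B x)%N].
have -> : count (fun x => t <= rep A B x)%N T = #|` S|.
  rewrite -size_filter; apply/perm_size/uniq_perm.
  - exact/filter_uniq/fset_uniq.
  - exact: fset_uniq.
  by move=> x; rewrite !inE mem_filter andbC.
apply: (rich_differences_bound fA fsep ACF) => x.
by rewrite !inE => /andP[].
Qed.

Lemma monotone_sum_difference_bound f A C F D :
  {in A &, {homo f : x y / x < y}} -> separates_differences f ->
  (forall a c, a \in A -> c \in C -> f a + c \in F) ->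
  (forall a b, a \in A -> b \in A -> a - b \in D) ->
  (0 < #|` A|)%N -> (0 < #|` C|)%N ->
  card A ^+ 11 * card C ^+ 3 <=
  18000 ^+ 2 * (card F ^+ 6 * card D ^+ 5 * (1 + ln (card A)) ^+ 2).
Proof.
move=> fA fsep ACF AD A0 C0; rewrite /card.
have [cAF cCF] := card_le_sums fA ACF A0 C0.
have h8 := card_exp8_le AD; rewrite -(ler_nat R) natrX !natrM in h8.
have D0 : (0 < #|` D|)%N.
  move: A0; rewrite !cardfs_gt0 => /fset0Pn[a aA].
  by apply/fset0Pn; exists (a - a); apply: AD.
set a : R := #|` A|%:R in h8 *; set c : R := #|` C|%:R; set u : R := #|` F|%:R.
set d : R := #|` D|%:R in h8 *.
have a0 : 0 < a by rewrite ltr0n.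
have a1 : 1 <= a by rewrite ler1n.
have c0 : 0 < c by rewrite ltr0n.
have d1 : 1 <= d by rewrite ler1n.
have au : a <= u by rewrite ler_nat.
have cu : c <= u by rewrite ler_nat.
have u0 : 0 < u by apply: lt_le_trans au.
have d0 : 0 < d by apply: lt_le_trans d1.
have l0 : 0 <= 1 + ln a by rewrite addr_ge0 // ln_ge0.
have M0 (b : R) : 0 <= b -> 0 <= 100 * (u ^+ 2 * b ^+ 2) / c.
  by move=> b0; rewrite !(divr_ge0, mulr_ge0, exprn_ge0) // ltW.
have h3 := sum_cube_le A0 (rep_leql A A) (M0 a (ltW a0))
  (fun t _ => rep_level_bound A D t fA fsep ACF C0).
rewrite -/a in h3.
have WE : a * d = (\sum_(t <- diffset A D) rep A D t)%:R.
  by rewrite sum_rep_card ?natrM // => x y; apply: mem_diffset.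
(* The hypothesis [W <= M] of the second-moment bound, from [a c <= u^2] and [d <= d^2]. *)
have WM : a * d <= 100 * (u ^+ 2 * d ^+ 2) / c.
  rewrite ler_pdivlMr //.
  have h : a * c <= u * u by rewrite ler_pM // ltW.
  have h' : d <= d * d by rewrite ler_peMl // ltW.
  have := ler_pM (mulr_ge0 (ltW a0) (ltW c0)) (ltW d0) h h'.
  have : 0 <= u * u * (d * d) by rewrite !mulr_ge0 // ltW.
  lra.
have h2 := sum_sqr_le_geom (rep_leql A D) WE WM
  (fun t _ => rep_level_bound D (diffset A D) t fA fsep ACF C0).
move: h8 h3 h2; set E3 : R := (\sum_(t <- D) _)%:R.
set E2 : R := (\sum_(t <- diffset A D) _)%:R => h8 h3 h2.
have E30 : 0 <= E3 by [].
have E20 : 0 <= E2 by [].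
have {}h3 : E3 * c <= 300 * (u ^+ 2 * a ^+ 2) * (1 + ln a).
  rewrite -ler_pdivlMr //; apply: le_trans h3 _.
  by rewrite le_eqVlt; apply/orP; left; apply/eqP; field; rewrite gt_eqF.
have {}h2 : E2 ^+ 2 * c <= 3600 * (u ^+ 2 * d ^+ 3 * a).
  rewrite -ler_pdivlMr //; apply: le_trans h2 _.
  by rewrite le_eqVlt; apply/orP; left; apply/eqP; field; rewrite gt_eqF.
(* Squaring [a^8 <= E3 E2 d] and multiplying by [c^3] makes both energy bounds applicable; a factor
   [a^5] then cancels. The constant is [300^2 * 3600 = 18000^2]. *)
have a5 : 0 < a ^+ 5 by rewrite exprn_gt0.
rewrite -(ler_pM2l a5).
have -> : a ^+ 5 * (a ^+ 11 * c ^+ 3) = (a ^+ 8) ^+ 2 * c ^+ 3 by ring.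
apply: (@le_trans _ _ ((E3 * E2 * d) ^+ 2 * c ^+ 3)).
  rewrite ler_wpM2r ?exprn_ge0 ?(ltW c0) // ler_pXn2r ?nnegrE ?exprn_ge0 ?(ltW a0) //.
  by rewrite !mulr_ge0.
have -> : (E3 * E2 * d) ^+ 2 * c ^+ 3 = (E3 * c) ^+ 2 * (E2 ^+ 2 * c) * d ^+ 2 by ring.
have -> : a ^+ 5 * (18000 ^+ 2 * (u ^+ 6 * d ^+ 5 * (1 + ln a) ^+ 2)) =
   (300 * (u ^+ 2 * a ^+ 2) * (1 + ln a)) ^+ 2 * (3600 * (u ^+ 2 * d ^+ 3 * a)) * d ^+ 2.
  by ring.
move: (300 * _ * _) (3600 * _) h3 h2 => p q h3 h2.
have Ec0 : 0 <= E3 * c by rewrite mulr_ge0 // ltW.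
have p0 : 0 <= p by apply: le_trans h3.
rewrite ler_wpM2r ?exprn_ge0 ?(ltW d0) // ler_pM ?exprn_ge0 //.
  by rewrite mulr_ge0 ?exprn_ge0 // ltW.
by rewrite ler_pXn2r ?nnegrE.
Qed.

(** * Consequences of convexity and reduction to the increasing case *)

Lemma strictly_convexN f : strictly_concave f -> strictly_convex (fun x => - f x).
Proof.
move=> h x y t xy t0 t1; have := h x y t xy t0 t1; lra.
Qed.

(** Both [a + d] and [b] lie between [a] and [b + d], with the weights [t] and [1 - t] interchanged;
    add the two convexity inequalities. *)
Lemma strictly_convex_differences f (a b d : R) : strictly_convex f ->
  0 < d -> a < b -> f (a + d) - f a < f (b + d) - f b.
Proof.
move=> fc d0 ab; pose l := b + d - a; pose t := (b - a) / l.
have l0 : 0 < l by rewrite /l; lra.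
have ln0 : l != 0 by rewrite gt_eqF.
have t0 : 0 < t by rewrite divr_gt0 // subr_gt0.
have t1 : t < 1 by rewrite ltr_pdivrMr // /l; lra.
have nab : a != b + d by rewrite lt_eqF //; lra.
have tl : t * l = b - a by rewrite divfK.
have e1 : t * a + (1 - t) * (b + d) = a + d by move: tl; rewrite /l; lra.
have e2 : (1 - t) * a + (1 - (1 - t)) * (b + d) = b by move: tl; rewrite /l; lra.
have := fc _ _ _ nab t0 t1; rewrite e1.
have t'0 : 0 < 1 - t by lra.
have t'1 : 1 - t < 1 by lra.
have := fc _ _ _ nab t'0 t'1; rewrite e2.
lra.
Qed.

Lemma strictly_convex_separates f : strictly_convex f -> separates_differences f.
Proof.
move=> fc; have pos a b d : 0 < d -> f (a + d) - f a = f (b + d) - f b -> a = b.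
  move=> d0 e; apply/eqP; case: (ltgtP a b) => // h.
    by have := strictly_convex_differences fc d0 h; rewrite e ltxx.
  by have := strictly_convex_differences fc d0 h; rewrite e ltxx.
move=> a b d dn e; case: (ltgtP d 0) => [d0|d0|d0]; last by rewrite d0 eqxx in dn.
  (* For negative [d], use the base points [a + d], [b + d] and the step [-d]. *)
  apply: (addIr d); apply: (pos _ _ (- d)); first by rewrite oppr_gt0.
  by rewrite !addrK; lra.
exact: pos e.
Qed.

Lemma separates_differencesN f :
  separates_differences f -> separates_differences (fun x => - f x).
Proof. by move=> h a b d d0 e; apply: (h a b d) => //; lra. Qed.

Lemma strictly_convex_lt_max f (x y z : R) : strictly_convex f ->
  x < y -> y < z -> f y < Num.max (f x) (f z).
Proof.
move=> fc xy yz; pose t := (z - y) / (z - x).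
have l0 : 0 < z - x by rewrite subr_gt0 (lt_trans xy).
have t0 : 0 < t by rewrite divr_gt0 // subr_gt0.
have t1 : t < 1 by rewrite ltr_pdivrMr //; lra.
have nxz : x != z by rewrite lt_eqF // (lt_trans xy).
have tl : t * (z - x) = z - y by rewrite divfK // gt_eqF.
have e1 : t * x + (1 - t) * z = y by lra.
have := fc _ _ _ nxz t0 t1; rewrite e1 => /lt_le_trans; apply.
have h1 : f x <= Num.max (f x) (f z) by rewrite le_max lexx.
have h2 : f z <= Num.max (f x) (f z) by rewrite le_max lexx orbT.
have h3 : t * f x <= t * Num.max (f x) (f z) by rewrite ler_pM2l.
have h4 : (1 - t) * f z <= (1 - t) * Num.max (f x) (f z) by rewrite ler_pM2l ?subr_gt0.
lra.
Qed.

(** Split [A] at a minimum point [m]. Of three points the middle one has value below the larger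
    outer value; with [m] as one outer point, minimality singles out the other. Taking [m] rightmost
    makes [f] increase strictly from [m] itself. *)
Lemma strictly_convex_monotone_half f A : strictly_convex f ->
  exists2 A', {subset A' <= A} & (#|` A| <= 2 * #|` A'|)%N /\
    ({in A' &, {homo f : x y / x < y}} \/ {in A' &, {homo f : x y / x < y >-> y < x}}).
Proof.
move=> fc; have [->|[a0 a0A]] := fset_0Vmem A.
  by exists fset0 => //; split=> //; left.
(* [m] is the rightmost point of [A] at which [f] is minimal on [A]. *)
have [m mA [mmin mlt]] : exists2 m, m \in A & (forall x, x \in A -> f m <= f x) /\
    (forall x, x \in A -> m < x -> f m < f x).
  case: (@arg_minP _ _ _ [` a0A] xpredT (fun x : A => f (val x)) isT) => m0 _ h0.
  case: (@arg_maxP _ _ _ m0 (fun x => f (val x) <= f (val m0)) (fun x : A => val x) (lexx _)).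
  move=> m hm h; exists (val m); first exact: valP.
  split=> x xA; first exact: le_trans hm (h0 [` xA] isT).
  move=> mx; rewrite ltNge; apply/negP => xm.
  by have := h [` xA] (le_trans xm hm); rewrite /= leNgt mx.
pose U := [fset x in A | m <= x]; pose L := A `\` U.
have cUL : (#|` A| = #|` U| + #|` L|)%N.
  by rewrite -(cardfsID U A) (fsetIidPr _) //; apply: fset_sub.
have fU : {in U &, {homo f : x y / x < y}}.
  move=> x y; rewrite !inE /= => /andP[xA mx] /andP[yA my] xy.
  move: mx; rewrite le_eqVlt => /predU1P[mx|mx]; first by subst x; apply: mlt.
  have := strictly_convex_lt_max fc mx xy.
  by rewrite lt_max => /orP[] //; rewrite ltNge mmin.
have fL : {in L &, {homo f : x y / x < y >-> y < x}}.
  move=> x y; rewrite !inE /= => /andP[+ xA] /andP[+ yA] xy.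
  rewrite xA yA /= -!ltNge => xm ym.
  have := strictly_convex_lt_max fc xy ym.
  by rewrite lt_max => /orP[] //; rewrite ltNge mmin.
have [UL|LU] := leqP #|` L| #|` U|.
  exists U; first by move=> x; rewrite !inE => /andP[].
  by split; [lia | left].
exists L; first by move=> x; rewrite !inE => /andP[].
by split; [lia | right].
Qed.

Lemma monotone_half f A : strictly_convex f \/ strictly_concave f ->
  exists2 A', {subset A' <= A} & (#|` A| <= 2 * #|` A'|)%N /\
    ({in A' &, {homo f : x y / x < y}} \/ {in A' &, {homo f : x y / x < y >-> y < x}}).
Proof.
case=> [|/strictly_convexN] /(@strictly_convex_monotone_half _ A)// [A' sA [cA fA]].
exists A' => //; split=> //; case: fA => fA; [right|left] => x y xA yA xy;
  by rewrite -ltrN2; apply: fA.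
Qed.

Lemma separates_differences_convex f :
  strictly_convex f \/ strictly_concave f -> separates_differences f.
Proof.
case=> [/strictly_convex_separates//|/strictly_convexN/strictly_convex_separates].
move=> /separates_differencesN h a b d d0 e; apply: (h a b d) => //; lra.
Qed.

Lemma sum_difference_bound f A C :
  strictly_convex f \/ strictly_concave f ->
  (0 < #|` A|)%N -> (0 < #|` C|)%N ->
  card A ^+ 11 * card C ^+ 3 <=
  2 ^+ 11 * 18000 ^+ 2 *
  (card (sumset (image_fset f A) C) ^+ 6 * card (diffset A A) ^+ 5 *
   (1 + ln (card A)) ^+ 2).
Proof.
move=> fc A0 C0; have fsep := separates_differences_convex fc.
have [A' sA [cA fA]] := monotone_half A fc.
set F := sumset _ _; set D := diffset A A.
have A'0 : (0 < #|` A'|)%N by lia.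
have AD a b : a \in A' -> b \in A' -> a - b \in D.
  by move=> /sA aA /sA bA; apply: mem_diffset.
have AF a c : a \in A' -> c \in C -> f a + c \in F.
  move=> /sA aA cC; apply/imfset2P; exists (f a); first by apply/imfsetP; exists a.
  by exists c.
have H : card A' ^+ 11 * card C ^+ 3 <=
  18000 ^+ 2 * (card F ^+ 6 * card D ^+ 5 * (1 + ln (card A')) ^+ 2).
  case: fA => fA; first exact: (monotone_sum_difference_bound fA fsep AF AD).
  (* If [f] decreases on [A'], negate [f], [C] and [F]: sizes and [D] are unchanged. *)
  pose neg (X : {fset R}) : {fset R} := [fset - x | x in X].
  have cN X : #|` neg X| = #|` X| by rewrite card_imfset //; apply: oppr_inj.
  have := @monotone_sum_difference_bound (fun x => - f x) A' (neg C) (neg F) D.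
  rewrite /card !cN; apply=> //.
  - by move=> x y xA yA xy; rewrite ltrN2; apply: fA.
  - exact: separates_differencesN.
  move=> a _ aA /imfsetP[c cC ->]; apply/imfsetP; exists (f a + c); first exact: AF.
  by rewrite opprD.
have cA' : card A' <= card A by rewrite ler_nat; apply: (@card_le_image _ id).
have cAA : card A <= 2 * card A' by rewrite -natrM ler_nat.
have a0 : 0 < card A by rewrite ltr0n.
have a'0 : 0 < card A' by rewrite ltr0n.
have a'1 : 1 <= card A' by rewrite ler1n.
have c0 : 0 <= card C by [].
(* Passing from [A] to its monotone half costs the factor [2^11]. *)
apply: (@le_trans _ _ ((2 * card A') ^+ 11 * card C ^+ 3)).
  rewrite ler_wpM2r ?exprn_ge0 // ler_pXn2r ?nnegrE ?(ltW a0) //.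
  by rewrite mulr_ge0 // ltW.
have Q0 : 0 <= 18000 ^+ 2 :> R := exprn_ge0 2 (ler0n R 18000).
move: (18000 ^+ 2) Q0 H => Q Q0 H.
rewrite exprMn -[leLHS]mulrA -[leRHS]mulrA ler_pM2l ?exprn_gt0 //.
apply: le_trans H _; rewrite ler_wpM2l //.
rewrite ler_wpM2l ?mulr_ge0 ?exprn_ge0 //.
have l0 : 0 <= ln (card A') by rewrite ln_ge0.
have ll : ln (card A') <= ln (card A) by rewrite ler_ln ?posrE.
rewrite ler_pXn2r ?nnegrE ?lerD2l ?addr_ge0 //.
exact: le_trans l0 ll.
Qed.

(** [f] is injective on its monotone half. This allows [C = f(A)] with [K = 2]. *)
Lemma card_image_fset_ge f A : strictly_convex f \/ strictly_concave f ->
  2^-1 * card A <= card (image_fset f A).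
Proof.
move=> fc; have [A' sA [cA fA]] := monotone_half A fc; rewrite /card.
rewrite ler_pdivrMl // -natrM ler_nat (leq_trans cA) // leq_mul2l /=.
apply: (@card_le_image _ f) => [x y xA yA e|x /sA xA]; last by apply/imfsetP; exists x.
apply/eqP; case: fA => fA; case: (ltgtP x y) => // h.
- by have := fA _ _ xA yA h; rewrite e ltxx.
- by have := fA _ _ yA xA h; rewrite e ltxx.
- by have := fA _ _ xA yA h; rewrite e ltxx.
- by have := fA _ _ yA xA h; rewrite e ltxx.
Qed.

End SumDifference.

(** * Base-2 logarithms and the conclusion *)

Section Log.
Variable R : realType.

Lemma ln2_gt0 : 0 < ln 2 :> R.
Proof. by rewrite ln_gt0 // ltr1n. Qed.

Lemma log2_ge1 (x : R) : 2 <= x -> 1 <= log2 x.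
Proof.
move=> x2; rewrite /log2 ler_pdivlMr ?ln2_gt0 // mul1r ler_ln ?posrE //.
by apply: lt_le_trans x2.
Qed.

(** For [x >= 2] both [1] and [ln x] are at most [log2 x], the latter because [ln 2 <= 1]. *)
Lemma one_add_ln_le_log2 (x : R) : 2 <= x -> 1 + ln x <= 2 * log2 x.
Proof.
move=> x2; have h := log2_ge1 x2.
have lx : ln x = ln 2 * log2 x by rewrite /log2 mulrC divfK // gt_eqF // ln2_gt0.
have l2 : ln 2 <= 1 :> R.
  by have -> : 2 = 1 + 1 :> R by []; apply: le_ln1Dx; lra.
by rewrite lx; nra.
Qed.

Lemma log2_card_small (A : {fset R}) : (#|` A| <= 1)%N -> log2 (card A) = 0.
Proof.
rewrite /log2 /card; case: #|` A| => [|[|n]] // _; first by rewrite ln0 ?mul0r.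
by rewrite ln1 mul0r.
Qed.

End Log.

Theorem theorem1p1 (R : realType) :
  (forall K : R, 0 < K ->
    exists c : R, 0 < c /\
      forall (f : R -> R) (A C : {fset R}),
        continuous f ->
        strictly_convex f \/ strictly_concave f ->
        K^-1 * card A <= card C ->
        card C <= K * card A ->
        card A ^+ 14 / log2 (card A) ^+ 2 <=
          c * (card (sumset (image_fset f A) C) ^+ 6 *
               card (diffset A A) ^+ 5))
  /\
  (exists c : R, 0 < c /\
    forall (f : R -> R) (A : {fset R}),
      continuous f ->
      strictly_convex f \/ strictly_concave f ->
      card A `^ (14 / 11) / log2 (card A) `^ (2 / 11) <=
        c * Num.max (card (sumset (image_fset f A) (image_fset f A)))
                    (card (diffset A A))).
Proof.
have part1 (K : R) : 0 < K -> exists c : R, 0 < c /\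
      forall (f : R -> R) (A C : {fset R}),
        strictly_convex f \/ strictly_concave f ->
        K^-1 * card A <= card C ->
        card A ^+ 14 / log2 (card A) ^+ 2 <=
          c * (card (sumset (image_fset f A) C) ^+ 6 *
               card (diffset A A) ^+ 5).
  move=> K0; have Q0 : 0 < 2 ^+ 11 * 18000 ^+ 2 :> R.
    by apply: mulr_gt0; apply: exprn_gt0; rewrite ltr0n.
  have := @sum_difference_bound R; move: (2 ^+ 11 * _) Q0 => Q Q0 bound.
  (* [K^3] comes from [|A|^3 <= K^3 |C|^3], and [4] from [(1 + ln |A|)^2 <= 4 (log2 |A|)^2]. *)
  have c0 : 0 < K ^+ 3 * Q * 4 by rewrite !mulr_gt0 ?exprn_gt0.
  exists (K ^+ 3 * Q * 4); split=> // f A C fc KAC.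
  have FD0 : 0 <= card (sumset (image_fset f A) C) ^+ 6 * card (diffset A A) ^+ 5 :> R.
    by rewrite mulr_ge0 ?exprn_ge0.
  (* Here the logarithm is 0, and so is the quotient by its square. *)
  have [A1|A2] := leqP #|` A| 1.
    rewrite log2_card_small // expr0n invr0 mulr0.
    by rewrite mulr_ge0 // ltW.
  have a2 : 2 <= card A by rewrite ler_nat.
  have a0 : 0 < card A by apply: lt_le_trans a2.
  have cC0 : 0 < card C by apply: lt_le_trans KAC; rewrite mulr_gt0 ?invr_gt0.
  have KAC' : card A <= K * card C by rewrite -ler_pdivrMl.
  have l1 := log2_ge1 a2.
  have l0 : 0 < log2 (card A) by apply: lt_le_trans l1.
  rewrite ler_pdivrMr ?exprn_gt0 //.
  have C0 : (0 < #|` C|)%N by rewrite -(ltr0n R).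
  have H := bound f A C fc (ltnW A2) C0.
  apply: (@le_trans _ _ (K ^+ 3 * (card A ^+ 11 * card C ^+ 3))).
    rewrite (exprD _ 11 3) [leRHS]mulrCA ler_pM2l ?exprn_gt0 // -exprMn.
    by rewrite ler_pXn2r ?nnegrE ?mulr_ge0 ?(ltW K0) ?(ltW a0) ?(ltW cC0).
  have h : (1 + ln (card A)) ^+ 2 <= 4 * log2 (card A) ^+ 2.
    have -> : 4 * log2 (card A) ^+ 2 = (2 * log2 (card A)) ^+ 2 by ring.
    rewrite ler_pXn2r ?nnegrE ?one_add_ln_le_log2 //.
      by rewrite addr_ge0 // ln_ge0 // (le_trans _ a2) // ler1n.
    by rewrite mulr_ge0 // ltW.
  move: FD0 H; set FD := _ ^+ 6 * _ => FD0 H.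
  have -> : K ^+ 3 * Q * 4 * FD * log2 (card A) ^+ 2 =
     K ^+ 3 * (Q * (FD * (4 * log2 (card A) ^+ 2))) by ring.
  rewrite ler_pM2l ?exprn_gt0 //; apply: le_trans H _.
  by rewrite ler_pM2l // ler_wpM2l.
split=> [K K0|].
  have [c [c0 H]] := part1 K K0; exists c; split=> // f A C _ fc KAC _.
  exact: H.
have [c [c0 H]] := part1 2 (ltr0Sn _ _).
exists (c `^ (1%N%:R / 11)); split=> [|f A _ fc]; first exact: powR_gt0.
have {}H := H f A (image_fset f A) fc (card_image_fset_ge A fc).
move: H; set F := card (sumset _ _); set D := card (diffset A A) => H.
set m := Num.max F D; set l := log2 (card A) in H *.
have F0 : 0 <= F by [].
have D0 : 0 <= D by [].
have Fm : F <= m by rewrite le_max lexx.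
have Dm : D <= m by rewrite le_max lexx orbT.
have m0 : 0 <= m by apply: le_trans Fm.
have l0 : 0 <= l.
  have [A1|A2] := leqP #|` A| 1; first by rewrite /l log2_card_small.
  by rewrite (le_trans ler01) // log2_ge1 // ler_nat.
have p11 (x : R) (k : nat) : 0 <= x -> (x `^ (k%:R / 11)) ^+ 11 = x ^+ k.
  move=> x0; rewrite -powR_mulrn ?powR_ge0 // -powRrM divfK ?pnatr_eq0 //.
  exact: powR_mulrn.
(* The eleventh power clears the fractional exponents; what remains is the first part together with
   [F^6 D^5 <= m^11]. *)
rewrite -(@ler_pXn2r _ 11) ?nnegrE ?divr_ge0 ?mulr_ge0 ?powR_ge0 //.
rewrite expr_div_n exprMn !p11 ?(ltW c0) // expr1.
apply: le_trans H _; rewrite ler_pM2l // (exprD m 6 5).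
by rewrite ler_pM ?exprn_ge0 // ler_pXn2r ?nnegrE.
Qed.
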